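(* Let $(B,\mathbb{T},\omega)$ be a $C^*$-dynamical system, and suppose that $A$ is a maximal (abelian $\mathbb{T}$-invariant $*$-subalgebra) of $B$. Then $A$ is a maximal abelian subalgebra of $B$.
   Context: A $C^*$-dynamical system $(B,\mathbb{T},\omega)$ consists of a $C^*$-algebra $B$ and a homomorphism $\omega:\mathbb{T}\to\mathrm{Aut}(B)$ such that $t\mapsto\omega_t(b)$ is norm-continuous for each $b\in B$. A $*$-subalgebra $A\subset B$ is $\mathbb{T}$-invariant if $\omega_t(a)\in A$ for all $a\in A$, $t\in\mathbb{T}$. A maximal (abelian $\mathbb{T}$-invariant $*$-subalgebra) is a $*$-subalgebra of $B$ which is abelian and $\mathbb{T}$-invariant and is maximal (under inclusion) among all abelian $\mathbb{T}$-invariant $*$-subalgebras of $B$. *)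

(* Defs.v *)
From mathcomp Require Import all_boot all_algebra.
From mathcomp Require Import complex.
From mathcomp Require Import all_classical all_reals all_analysis.
Import numFieldNormedType.Exports.
Local Open Scope ring_scope.
Local Open Scope classical_set_scope.

Set Implicit Arguments.
Unset Strict Implicit.
Unset Printing Implicit Defensive.

Section CstarDefs.
Variable R : realType.
Variable B : completeNormedModType R[i].
Variable mul : B -> B -> B.
Variable star : B -> B.

Definition is_Cstar_algebra : Prop :=
  (forall a b c : B, mul a (mul b c) = mul (mul a b) c) /\
  (forall a b c : B, mul (a + b) c = mul a c + mul b c) /\
  (forall a b c : B, mul a (b + c) = mul a b + mul a c) /\
  (forall (k : R[i]) (a b : B), mul (k *: a) b = k *: mul a b) /\
  (forall (k : R[i]) (a b : B), mul a (k *: b) = k *: mul a b) /\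
  (forall a b : B, `|mul a b| <= `|a| * `|b|) /\
  (forall a : B, star (star a) = a) /\
  (forall a b : B, star (a + b) = star a + star b) /\
  (forall (k : R[i]) (a : B), star (k *: a) = k^* *: star a) /\
  (forall a b : B, star (mul a b) = mul (star b) (star a)) /\
  (forall a : B, `|mul (star a) a| = `|a| ^+ 2).

Definition is_star_automorphism (f : B -> B) : Prop :=
  [/\ (forall a b : B, f (a + b) = f a + f b),
      (forall (k : R[i]) (a : B), f (k *: a) = k *: f a),
      (forall a b : B, f (mul a b) = mul (f a) (f b)),
      (forall a : B, f (star a) = star (f a)) &
      bijective f].

(* The circle group T is represented as R/Z: a map on T is a 1-periodic map on R.
   (B, T, omega) is a C*-dynamical system: omega : T -> Aut(B) is a group
   homomorphism (omega 0 = id, omega (s + t) = omega s o omega t, 1-periodic)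
   and t |-> omega t b is norm-continuous for every b. *)
Definition is_Cstar_dynamical_system (omega : R -> B -> B) : Prop :=
  [/\ (forall t : R, is_star_automorphism (omega t)),
      (forall b : B, omega 0 b = b),
      (forall (s t : R) (b : B), omega (s + t) b = omega s (omega t b)),
      (forall (t : R) (b : B), omega (t + 1) b = omega t b) &
      (forall b : B, continuous (fun t : R => omega t b))].

Definition is_subalgebra (A : set B) : Prop :=
  [/\ A 0,
      (forall a b, A a -> A b -> A (a + b)),
      (forall (k : R[i]) a, A a -> A (k *: a)) &
      (forall a b, A a -> A b -> A (mul a b))].

Definition is_star_subalgebra (A : set B) : Prop :=
  is_subalgebra A /\ (forall a, A a -> A (star a)).

Definition is_abelian (A : set B) : Prop :=
  forall a b, A a -> A b -> mul a b = mul b a.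

Definition is_T_invariant (omega : R -> B -> B) (A : set B) : Prop :=
  forall (t : R) a, A a -> A (omega t a).

Definition is_abelian_T_invariant_star_subalgebra (omega : R -> B -> B)
    (A : set B) : Prop :=
  [/\ is_star_subalgebra A, is_abelian A & is_T_invariant omega A].

Definition is_maximal_abelian_T_invariant_star_subalgebra
    (omega : R -> B -> B) (A : set B) : Prop :=
  is_abelian_T_invariant_star_subalgebra omega A /\
  (forall A' : set B, is_abelian_T_invariant_star_subalgebra omega A' ->
     A `<=` A' -> A' = A).

Definition is_maximal_abelian_subalgebra (A : set B) : Prop :=
  (is_subalgebra A /\ is_abelian A) /\
  (forall A' : set B, is_subalgebra A' -> is_abelian A' -> A `<=` A' -> A' = A).

End CstarDefs.

(* Main.v *)
(* Let A' be the commutant of A; it suffices that A' is contained in A. Maximality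
   gives S'' = A for every self-adjoint commuting set S containing A which omega
   preserves up to scalars, because S'' is then an abelian T-invariant
   star-subalgebra; in particular A is closed. If x in A' is an eigenvector of
   omega, then p = x^* x and q = x x^* are normal eigenvectors in A', so they lie
   in A and commute with x. This forces (p - q)^2 = 0, so x is normal and lies
   in A as well. The Fourier coefficients of any b in A' are such eigenvectors,
   and b is the limit of its Fejer means, so b lies in A.

   Integrals over the circle are replaced by limits of Riemann sums over dyadic
   grids. These commute with omega because star-automorphisms are bounded: if h
   is self-adjoint and small, 1 - h^2 has a square root 1 - k in the unitization,
   so h + i (1 - k) is unitary, and its image is again unitary. *)
Require Import Defs.
From mathcomp Require Import all_boot all_order all_algebra.
From mathcomp Require Import complex.
From mathcomp Require Import all_classical all_reals all_analysis.
From mathcomp Require Import ring lra.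
Import numFieldNormedType.Exports.
Import Order.TTheory GRing.Theory Num.Theory.
Local Open Scope ring_scope.
Local Open Scope classical_set_scope.

Set Implicit Arguments.
Unset Strict Implicit.
Unset Printing Implicit Defensive.

(** * The norm as a real number *)

Section RealNorm.
Variable R : realType.

(** The norm of a complex normed space is valued in [R[i]]; its real part loses nothing and puts
    estimates in the ordered field [R], within reach of [lra]. *)
Definition nrm (V : normedZmodType R[i]) (a : V) : R := complex.Re `|a|.

Lemma nrmE (V : normedZmodType R[i]) (a : V) : `|a| = (nrm a)%:C%C.
Proof. by rewrite /nrm RRe_real. Qed.

Lemma nrm_ge0 (V : normedZmodType R[i]) (a : V) : 0 <= nrm a.
Proof. by rewrite -(lecR 0) -nrmE normr_ge0. Qed.

Lemma nrm_eq0 (V : normedZmodType R[i]) (a : V) : nrm a = 0 -> a = 0.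
Proof. by move=> a0; apply/normr0_eq0; rewrite nrmE a0. Qed.

Lemma nrm0 (V : normedZmodType R[i]) : nrm (0 : V) = 0.
Proof. by rewrite /nrm normr0. Qed.

Lemma nrmN (V : normedZmodType R[i]) (a : V) : nrm (- a) = nrm a.
Proof. by rewrite /nrm normrN. Qed.

Lemma nrmB (V : normedZmodType R[i]) (a b : V) : nrm (a - b) = nrm (b - a).
Proof. by rewrite -nrmN opprB. Qed.

Lemma nrmD (V : normedZmodType R[i]) (a b : V) : nrm (a + b) <= nrm a + nrm b.
Proof. by rewrite -lecR rmorphD /= -!nrmE ler_normD. Qed.

Lemma nrm_sum (V : normedZmodType R[i]) (I : Type) (r : seq I) (F : I -> V) :
  nrm (\sum_(i <- r) F i) <= \sum_(i <- r) nrm (F i).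
Proof.
elim: r => [|i r IH]; first by rewrite !big_nil nrm0.
by rewrite !big_cons; apply: le_trans (nrmD _ _) _; rewrite lerD2l.
Qed.

Lemma nrmM (k l : R[i]) : nrm (k * l) = nrm k * nrm l.
Proof. by apply: complexI; rewrite rmorphM /= -!nrmE normrM. Qed.

Lemma nrm_real (x : R) : nrm (x%:C)%C = `|x|.
Proof. by rewrite /nrm normc_def /= expr0n /= addr0 sqrtr_sqr. Qed.

(** * Sequences and limits in [B] *)

Variable B : completeNormedModType R[i].
Implicit Types (a b : B) (u : nat -> B).

Lemma nrmZ (k : R[i]) a : nrm (k *: a) = nrm k * nrm a.
Proof. by apply: complexI; rewrite rmorphM /= -!nrmE normrZ. Qed.

Lemma nrmV N (a : B) : nrm ((N%:R^-1 : R[i]) *: a) = N%:R^-1 * nrm a.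
Proof.
rewrite nrmZ; congr (_ * _).
have := nrm_real (N%:R^-1 : R); rewrite fmorphV rmorph_nat /= => ->.
by rewrite ger0_norm // invr_ge0.
Qed.

Lemma cvg_nrmP u a : u @ \oo --> a <->
  forall e : R, 0 < e -> exists N, forall n, (N <= n)%N -> nrm (u n - a) < e.
Proof.
split=> [/cvgrPdist_lt ua e e0|ua].
  have /ua [N _ uN] : 0 < (e%:C)%C by rewrite ltcR.
  exists N => n Nn; rewrite nrmB -ltcR -nrmE; exact: uN.
(* Here [e] is complex; being positive forces its imaginary part to vanish, so its real part serves
   as the bound. *)
apply/cvgrPdist_lt => e; rewrite ltcE => /andP[/eqP/= e1 e0].
have [N uN] := ua _ e0; exists N => // n /= /uN.
by rewrite nrmB -ltcR -nrmE => /lt_le_trans; apply; rewrite lecE /= e1 eqxx lexx.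
Qed.

Lemma cauchy_nrm u :
  (forall e : R, 0 < e -> exists N, forall m n,
     (N <= m)%N -> (N <= n)%N -> nrm (u m - u n) < e) ->
  exists a, u @ \oo --> a.
Proof.
move=> uC; suff: cauchy (u @ \oo) by move/cauchy_cvg => /cvg_ex.
apply: cauchy_exP => e; rewrite ltcE => /andP[/eqP/= e1 e0].
have [N uN] := uC _ e0; exists (u N); exists N => // n /= Nn.
rewrite -ball_normE /=.
have := uN _ _ (leqnn N) Nn; rewrite -ltcR -nrmE => /lt_le_trans; apply.
by rewrite lecE /= e1 eqxx lexx.
Qed.

(** Additivity is asked for rather than linearity, so that the conjugate-linear [star] is
    covered. *)
Lemma cvg_additive (F : B -> B) (C : R) u a :
  (forall x y, F (x - y) = F x - F y) -> (forall x, nrm (F x) <= C * nrm x) ->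
  u @ \oo --> a -> F (u n) @[n --> \oo] --> F a.
Proof.
move=> FB FC /cvg_nrmP ua; apply/cvg_nrmP => e e0.
have C1 : 0 < `|C| + 1 by rewrite ltr_wpDl.
have [N uN] := ua (e / (`|C| + 1)) (divr_gt0 e0 C1).
exists N => n /uN; rewrite ltr_pdivlMr // => /(le_lt_trans _); apply.
rewrite -FB (le_trans (FC _)) // mulrC ler_wpM2l ?nrm_ge0 //.
by rewrite (le_trans (ler_norm _)) // lerDl.
Qed.

Lemma cvg_nrm_unique u a b : u @ \oo --> a -> u @ \oo --> b -> a = b.
Proof. exact: cvg_unique. Qed.

Lemma nrm_cvg_le u a (C : R) : u @ \oo --> a -> (forall n, nrm (u n) <= C) ->
  nrm a <= C.
Proof.
move=> /cvg_nrmP ua uC; apply/ler_addgt0Pr => e /ua[N /(_ _ (leqnn N))].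
rewrite nrmB => aN; have := nrmD (a - u N) (u N); rewrite subrK.
by have := uC N; lra.
Qed.

Lemma expr_half_lt (e : R) : 0 < e -> exists N : nat, 2^-1 ^+ N < e.
Proof.
move=> e0; have h1 : `|2^-1 : R| < 1 by rewrite ger0_norm ?invr_ge0 // invf_lt1 ?ltr1n.
have /cvgrPdist_lt /(_ _ e0) [N _ /(_ _ (leqnn N))] /= := cvg_expr h1.
by rewrite sub0r normrN ger0_norm ?exprn_ge0 ?invr_ge0 //; exists N.
Qed.

End RealNorm.

(** * Automorphisms of C*-algebras are bounded *)

Section CstarAlgebra.
Variables (R : realType) (B : completeNormedModType R[i]).
Variables (mul : B -> B -> B) (star : B -> B).
Hypothesis hB : is_Cstar_algebra mul star.
Implicit Types (a b c d h : B).

Lemma cmulA a b c : mul a (mul b c) = mul (mul a b) c.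
Proof. by case: hB => ->. Qed.

Lemma cmulDl a b c : mul (a + b) c = mul a c + mul b c.
Proof. by case: hB => _ [-> _]. Qed.

Lemma cmulDr a b c : mul a (b + c) = mul a b + mul a c.
Proof. by case: hB => _ [_ [-> _]]. Qed.

Lemma cmulZl (k : R[i]) a b : mul (k *: a) b = k *: mul a b.
Proof. by case: hB => _ [_ [_ [-> _]]]. Qed.

Lemma cmulZr (k : R[i]) a b : mul a (k *: b) = k *: mul a b.
Proof. by case: hB => _ [_ [_ [_ [-> _]]]]. Qed.

Lemma nrm_mul a b : nrm (mul a b) <= nrm a * nrm b.
Proof.
case: hB => _ [_ [_ [_ [_ [h _]]]]].
by rewrite -lecR rmorphM /= -!nrmE.
Qed.

Lemma starK a : star (star a) = a.
Proof. by case: hB => _ [_ [_ [_ [_ [_ [-> _]]]]]]. Qed.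

Lemma starD a b : star (a + b) = star a + star b.
Proof. by case: hB => _ [_ [_ [_ [_ [_ [_ [-> _]]]]]]]. Qed.

Lemma starZ (k : R[i]) a : star (k *: a) = k^* *: star a.
Proof. by case: hB => _ [_ [_ [_ [_ [_ [_ [_ [-> _]]]]]]]]. Qed.

Lemma starM a b : star (mul a b) = mul (star b) (star a).
Proof. by case: hB => _ [_ [_ [_ [_ [_ [_ [_ [_ [-> _]]]]]]]]]. Qed.

Lemma nrm_starM a : nrm (mul (star a) a) = nrm a ^+ 2.
Proof.
case: hB => _ [_ [_ [_ [_ [_ [_ [_ [_ [_ h]]]]]]]]].
by apply: complexI; rewrite rmorphXn /= -!nrmE.
Qed.

Lemma cmulNl a b : mul (- a) b = - mul a b.
Proof. by rewrite -scaleN1r cmulZl scaleN1r. Qed.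

Lemma cmulNr a b : mul a (- b) = - mul a b.
Proof. by rewrite -scaleN1r cmulZr scaleN1r. Qed.

Lemma cmulBl a b c : mul (a - b) c = mul a c - mul b c.
Proof. by rewrite cmulDl cmulNl. Qed.

Lemma cmulBr a b c : mul a (b - c) = mul a b - mul a c.
Proof. by rewrite cmulDr cmulNr. Qed.

Lemma cmul0l a : mul 0 a = 0.
Proof. by rewrite -(scale0r a) cmulZl !scale0r. Qed.

Lemma cmul0r a : mul a 0 = 0.
Proof. by rewrite -(scale0r a) cmulZr !scale0r. Qed.

Lemma star0 : star 0 = 0.
Proof. by rewrite -(scale0r (0 : B)) starZ conjC0 !scale0r. Qed.

Lemma starN a : star (- a) = - star a.
Proof. by rewrite -scaleN1r starZ rmorphN1 scaleN1r. Qed.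

Lemma starB a b : star (a - b) = star a - star b.
Proof. by rewrite starD starN. Qed.

(** The C*-identity gives |b|^2 = |b^* b| <= |b^*| |b|; cancel |b|, then exchange b and its
    adjoint. *)
Lemma nrm_star a : nrm (star a) = nrm a.
Proof.
suff le b : nrm b <= nrm (star b).
  by apply/eqP; rewrite eq_le le -{2}(starK a) le.
have := nrm_mul (star b) b; rewrite nrm_starM expr2.
have := nrm_ge0 b; rewrite le_eqVlt => /orP[/eqP <- _|b0].
  exact: nrm_ge0.
by rewrite ler_pM2r.
Qed.

(** Stated for a generic [k] to serve both i and -i; the cross terms of the C*-identity cancel. *)
Lemma nrm_addi (k : R[i]) c d : k^* = - k -> k * k = -1 ->
  mul (star c) d = mul (star d) c ->
  nrm (c + k *: d) ^+ 2 = nrm (mul (star c) c + mul (star d) d).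
Proof.
move=> kJ kk cd; rewrite -nrm_starM starD starZ cmulDl !cmulDr !cmulZl !cmulZr.
by rewrite kJ cd scalerA mulNr kk opprK scale1r !scaleNr addrA addrK.
Qed.

(* [c + i d] and [c - i d] both have the norm of [b], and [c] is their mean. *)
Lemma nrm_le_of_sum_squares b c d :
  mul (star c) c + mul (star d) d = mul (star b) b ->
  mul (star c) d = mul (star d) c -> nrm c <= nrm b.
Proof.
move=> cdb cd.
have sq (x : B) : nrm x ^+ 2 = nrm b ^+ 2 -> nrm x = nrm b.
  by move/eqP; rewrite eqrXn2 ?nrm_ge0 // => /eqP.
have e1 : nrm (c + 'i *: d) = nrm b.
  apply: sq; rewrite nrm_addi ?cdb ?nrm_starM ?conjCi //.
  by rewrite -expr2 sqrCi.
have e2 : nrm (c + (- 'i) *: d) = nrm b.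
  have iJ : (- 'i : R[i])^* = - - 'i by rewrite rmorphN /= conjCi.
  have ii : (- 'i : R[i]) * - 'i = -1 by rewrite mulrNN -expr2 sqrCi.
  by apply: sq; rewrite (nrm_addi iJ ii) // cdb nrm_starM.
have : nrm (2 *: c) <= nrm b + nrm b.
  rewrite -{1}e1 -e2; apply: le_trans (nrmD _ _).
  by rewrite scaleNr addrACA subrr addr0 scaler_nat mulr2n.
have -> : nrm (2 *: c) = 2 * nrm c.
  by rewrite nrmZ; have := nrm_real (2 : R); rewrite rmorph_nat normr_nat => ->.
by lra.
Qed.

(** Fixed-point iteration from 0 for k = (h^2 + k^2) / 2, which says formally that (1 - k)^2 = 1 -
    h^2. *)
Fixpoint quad_iter h (n : nat) : B :=
  if n is m.+1 then 2^-1 *: (mul h h + mul (quad_iter h m) (quad_iter h m))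
  else 0.

Lemma quad_iter_le h n : nrm h <= 2^-1 -> nrm (quad_iter h n) <= 2^-1.
Proof.
move=> h1; elim: n => [|n IH] /=; first by rewrite nrm0 invr_ge0.
rewrite nrmV.
have : nrm (mul h h + mul (quad_iter h n) (quad_iter h n)) <=
   2^-1 * 2^-1 + 2^-1 * 2^-1.
  apply: le_trans (nrmD _ _) _; apply: lerD.
    by apply: le_trans (nrm_mul _ _) _; rewrite ler_pM ?nrm_ge0.
  by apply: le_trans (nrm_mul _ _) _; rewrite ler_pM ?nrm_ge0.
by lra.
Qed.

Lemma nrm_sqrB (C : R) a b : nrm a <= C -> nrm b <= C ->
  nrm (mul a a - mul b b) <= 2 * C * nrm (a - b).
Proof.
move=> aC bC.
have -> : mul a a - mul b b = mul a (a - b) + mul (a - b) b.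
  by rewrite cmulBr cmulBl addrA subrK.
apply: le_trans (nrmD _ _) _.
have := nrm_mul a (a - b); have := nrm_mul (a - b) b.
have := ler_wpM2l (nrm_ge0 (a - b)) aC; have := ler_wpM2l (nrm_ge0 (a - b)) bC.
by lra.
Qed.

(** On the ball of radius 1/2, squaring is 1-Lipschitz, so the iterated map is a contraction of
    ratio 1/2. *)
Lemma quad_iter_cauchy h n m : nrm h <= 2^-1 ->
  nrm (quad_iter h (n + m) - quad_iter h n) <= 2^-1 ^+ n.
Proof.
move=> h1; elim: n => [|n IH] /=.
  by rewrite subr0 expr0 (le_trans (quad_iter_le _ h1)) // invf_le1 ?ler1n.
rewrite -scalerBr opprD addrACA subrr add0r nrmV.
have := nrm_sqrB (quad_iter_le (n + m) h1) (quad_iter_le n h1).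
by rewrite exprS; lra.
Qed.

(* [1 - k] is a square root of [1 - h^2] in the unitization. *)
Lemma sqrt_one_minus_sqr h : star h = h -> nrm h <= 2^-1 ->
  exists k, [/\ star k = k, mul h k = mul k h &
    mul h h + mul k k = k + k].
Proof.
move=> hs h1.
have [k kh] : exists k : B, quad_iter h @ \oo --> k.
  apply: cauchy_nrm => e e0.
  have [N eN] := expr_half_lt (divr_gt0 e0 (ltr0Sn _ 1)).
  exists N => m n Nm Nn.
  have := quad_iter_cauchy N (m - N) h1; have := quad_iter_cauchy N (n - N) h1.
  rewrite !subnKC // => hn hm.
  have := nrmD (quad_iter h m - quad_iter h N) (quad_iter h N - quad_iter h n).
  by rewrite addrA subrK (nrmB (quad_iter h N)); lra.
have k1 : nrm k <= 2^-1 by apply: (nrm_cvg_le kh) => n; exact: quad_iter_le.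
exists k; split.
- have star_iter : (fun n => star (quad_iter h n)) = quad_iter h.
    apply/funext; elim=> [|n IH] /=; first exact: star0.
    rewrite starZ starD !starM hs IH; congr (_ *: _).
    by rewrite fmorphV rmorph_nat.
  apply: cvg_nrm_unique (kh); rewrite -[X in X @ _ --> _]star_iter.
  by apply: (cvg_additive starB (C := 1)) kh => x; rewrite nrm_star mul1r.
- have comm_iter : (fun n => mul h (quad_iter h n)) = (fun n => mul (quad_iter h n) h).
    apply/funext; elim=> [|n IH] /=; first by rewrite cmul0l cmul0r.
    rewrite cmulZl cmulZr cmulDl cmulDr cmulA; congr (_ *: (_ + _)).
    by rewrite cmulA IH -cmulA IH cmulA.
  apply: (@cvg_nrm_unique _ _ (fun n => mul h (quad_iter h n))).
    by apply: (cvg_additive (cmulBr h) (C := nrm h)) kh => x; exact: nrm_mul.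
  rewrite comm_iter.
  apply: (cvg_additive (F := mul^~ h) (fun x y => cmulBl x y h) (C := nrm h)) kh => x.
  by rewrite mulrC; exact: nrm_mul.
- suff kE : (2^-1 : R[i]) *: (mul h h + mul k k) = k.
    rewrite -[in RHS]kE -scalerDl (_ : 2^-1 + 2^-1 = 1) ?scale1r //.
    by rewrite [RHS]splitr mul1r.
  (* The shifted iterates tend to [k], and by continuity of the square also to the left-hand
     side. *)
  apply: (@cvg_nrm_unique _ _ (fun n => quad_iter h n.+1)); last first.
    by rewrite cvg_shiftS.
  rewrite /=; apply/cvg_nrmP => e e0.
  have /cvg_nrmP /(_ _ e0) [N hN] := kh; exists N => n /hN kn.
  rewrite -scalerBr opprD addrACA subrr add0r nrmV.
  by have := nrm_sqrB (quad_iter_le n h1) k1; lra.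
Qed.

(** Small self-adjoint elements come first, then all self-adjoint ones by scaling to norm 1/2,
    whence the constant 2. In general |f(a)|^2 = |f(a^* a)| <= 2 |a|^2. *)
Lemma automorphism_bounded (f : B -> B) a : is_star_automorphism mul star f ->
  nrm (f a) <= 2 * nrm a.
Proof.
move=> [fD fZ fM fS _].
have small h : star h = h -> nrm h <= 2^-1 -> nrm (f h) <= 1.
  move=> hs /(sqrt_one_minus_sqr hs) [k [ks hk khk]].
  have fhs : star (f h) = f h by rewrite -fS hs.
  have fks : star (f k) = f k by rewrite -fS ks.
  have fhk : mul (f h) (f k) = mul (f k) (f h) by rewrite -!fM hk.
  have fsq : mul (f h) (f h) + mul (f k) (f k) = f k + f k.
    by rewrite -!fM -!fD khk.
  (* The unitary f(h) + i (1 - f(k)) is applied to [b] without adjoining a unit: c = f(h) b and d =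
     b - f(k) b satisfy c^* c + d^* d = b^* b. *)
  have le b : nrm (mul (f h) b) <= nrm b.
    apply: (@nrm_le_of_sum_squares _ _ (b - mul (f k) b)).
      rewrite starB !starM fhs fks.
      have hhb : mul (f h) (mul (f h) b) =
          mul (f k) b + mul (f k) b - mul (f k) (mul (f k) b).
        by rewrite !cmulA -cmulDl -fsq cmulDl addrK.
      have zmod (p q r : B) : p + p - q + (r - p - (p - q)) = r.
        by rewrite -[r - p - _]addrA -opprD [p + (p - q)]addrA [LHS]addrC subrK.
      by rewrite cmulBl !cmulBr -!cmulA hhb cmulBr cmulDr zmod.
    rewrite starB !starM fhs fks cmulBl cmulBr -!cmulA; congr (_ - mul _ _).
    by rewrite !cmulA fhk.
  have := le (f h); rewrite -{1}fhs nrm_starM expr2.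
  have := nrm_ge0 (f h); rewrite le_eqVlt => /orP[/eqP <- //|f0].
  by move=> ff; rewrite -(ler_pM2r f0) mul1r.
have selfadj h : star h = h -> nrm (f h) <= 2 * nrm h.
  move=> hs; have := nrm_ge0 h; rewrite le_eqVlt => /orP[/eqP/esym/nrm_eq0 ->|h0].
    have -> : f 0 = 0 by rewrite -(scale0r (0 : B)) fZ !scale0r.
    by rewrite nrm0 mulr0.
  set k : R := (2 * nrm h)^-1.
  have k0 : 0 < k by rewrite invr_gt0 mulr_gt0.
  have nk (x : B) : nrm (k%:C%C *: x) = k * nrm x by rewrite nrmZ nrm_real gtr0_norm.
  have := small (k%:C%C *: h); rewrite fZ !nk starZ hs => small'.
  have : k * nrm (f h) <= 1.
    apply: small'; first by rewrite conj_Creal // ger0_real // ler0c ltW.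
    by rewrite /k invfM -mulrA mulVf ?mulr1 // gt_eqF.
  by rewrite /k mulrC ler_pdivrMr ?mul1r // mulr_gt0.
rewrite -(@ler_pXn2r _ 2) ?nnegrE ?mulr_ge0 ?nrm_ge0 //.
rewrite -nrm_starM -fS -fM.
have := selfadj (mul (star a) a); rewrite starM starK nrm_starM => /(_ erefl).
have := sqr_ge0 (nrm a); rewrite exprMn; lra.
Qed.
End CstarAlgebra.

(** * Commutants and eigenvectors *)

Section Commutant.
Variables (R : realType) (B : completeNormedModType R[i]).
Variables (mul : B -> B -> B) (star : B -> B).
Hypothesis hB : is_Cstar_algebra mul star.

Definition commutant (X : set B) : set B :=
  [set y | forall x, X x -> mul x y = mul y x].

Lemma commutant_subalgebra X : is_subalgebra mul (commutant X).
Proof.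
split=> [x Xx|a b aX bX x Xx|k a aX x Xx|a b aX bX x Xx].
- by rewrite (cmul0l hB) (cmul0r hB).
- by rewrite (cmulDl hB) (cmulDr hB) aX // bX.
- by rewrite (cmulZl hB) (cmulZr hB) aX.
- by rewrite (cmulA hB) aX // -(cmulA hB) bX // (cmulA hB).
Qed.

Lemma commutant_star X y : (forall x, X x -> X (star x)) ->
  commutant X y -> commutant X (star y).
Proof.
move=> XS Xy x Xx.
by rewrite -(starK hB x) -!(starM hB) (Xy (star x)) //; exact: XS.
Qed.

Lemma commutantS X Y : X `<=` Y -> commutant Y `<=` commutant X.
Proof. by move=> XY y Yy x /XY; exact: Yy. Qed.

Lemma commutant2 X : X `<=` commutant (commutant X).
Proof. by move=> x Xx y Xy; rewrite Xy. Qed.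

Lemma commutant_cvg X (u : nat -> B) y : (forall n, commutant X (u n)) ->
  u @ \oo --> y -> commutant X y.
Proof.
move=> Xu uy x Xx.
apply: (@cvg_nrm_unique _ _ (fun n => mul x (u n))).
  by apply: (cvg_additive (cmulBr hB x) (C := nrm x)) uy => z; exact: (nrm_mul hB).
have -> : (fun n => mul x (u n)) = (fun n => mul (u n) x).
  by apply/funext => n; exact: Xu.
apply: (cvg_additive (fun a b => cmulBl hB a b x) (C := nrm x)) uy => z.
by rewrite mulrC; exact: (nrm_mul hB).
Qed.

(** * The circle action and commutants *)

Variable omega : R -> B -> B.
Hypothesis homega : is_Cstar_dynamical_system mul star omega.

Lemma omegaD t a b : omega t (a + b) = omega t a + omega t b.
Proof. by case: homega => /(_ t) [-> _]. Qed.

Lemma omegaZ t (k : R[i]) a : omega t (k *: a) = k *: omega t a.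
Proof. by case: homega => /(_ t) [_ ->]. Qed.

Lemma omegaM t a b : omega t (mul a b) = mul (omega t a) (omega t b).
Proof. by case: homega => /(_ t) [_ _ ->]. Qed.

Lemma omega_star t a : omega t (star a) = star (omega t a).
Proof. by case: homega => /(_ t) [_ _ _ ->]. Qed.

Lemma omega0 b : omega 0 b = b.
Proof. by case: homega => _ ->. Qed.

Lemma omega_add s t b : omega (s + t) b = omega s (omega t b).
Proof. by case: homega => _ _ ->. Qed.

Lemma omega_period t b : omega (t + 1) b = omega t b.
Proof. by case: homega => _ _ _ ->. Qed.

Lemma omegaB t a b : omega t (a - b) = omega t a - omega t b.
Proof. by rewrite omegaD -scaleN1r omegaZ scaleN1r. Qed.

Lemma omega_sum t (I : Type) (r : seq I) (F : I -> B) :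
  omega t (\sum_(i <- r) F i) = \sum_(i <- r) omega t (F i).
Proof.
elim: r => [|i r IH]; last by rewrite !big_cons omegaD IH.
by rewrite !big_nil -(scale0r (0 : B)) omegaZ !scale0r.
Qed.

Lemma nrm_omega t b : nrm (omega t b) <= 2 * nrm b.
Proof. by case: homega => aut _ _ _ _; exact: (automorphism_bounded hB). Qed.

Lemma omega_continuous0 b (e : R) : 0 < e ->
  exists2 d : R, 0 < d & forall t, `|t| < d -> nrm (omega t b - b) < e.
Proof.
move=> e0; case: homega => _ _ _ _ /(_ b 0) /cvgrPdist_lt.
have e0C : 0 < e%:C%C by rewrite ltcR.
move=> /(_ _ e0C); rewrite omega0 => /nbhs_ballP [d d0 dP].
exists d => // t td; have := dP t.
by rewrite /ball /= sub0r normrN => /(_ td); rewrite nrmE ltcR nrmB.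
Qed.

(** Every x in [X] is the image under [omega t] of a multiple of an element of [X], with which y
    commutes. The scalar allows [X] to contain eigenvectors without all their multiples. *)
Lemma commutant_invariant X :
  (forall t x, X x -> exists k : R[i], exists2 x', X x' & omega t x = k *: x') ->
  is_T_invariant omega (commutant X).
Proof.
move=> XT t y Xy x Xx; have [k [x' Xx' xE]] := XT (- t) x Xx.
have -> : x = omega t (k *: x') by rewrite -xE -omega_add subrr omega0.
by rewrite -!omegaM (cmulZl hB) (cmulZr hB) Xy.
Qed.

(** * Consequences of maximality *)

Variable A : set B.
Hypothesis hA :
  is_maximal_abelian_T_invariant_star_subalgebra mul star omega A.

(* The bicommutant of [S] is an abelian T-invariant star-subalgebra. *)
Lemma maximal_bicommutant (S : set B) : A `<=` S ->
  (forall x y, S x -> S y -> mul x y = mul y x) ->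
  (forall x, S x -> S (star x)) ->
  (forall t x, S x -> exists k : R[i], exists2 x', S x' & omega t x = k *: x') ->
  commutant (commutant S) = A.
Proof.
case: hA => _ maxA AS Sab Sstar ST.
apply: maxA; last by apply: subset_trans AS _; exact: commutant2.
have SS : S `<=` commutant S by move=> y Sy x Sx; exact: Sab.
split.
- split; first exact: commutant_subalgebra.
  by move=> a; apply: commutant_star => x; exact: commutant_star.
- move=> a b SSa SSb; apply/esym; apply: SSa.
  by apply: (commutantS SS) SSb.
- apply: commutant_invariant => t x Sx; exists 1, (omega t x).
    exact: commutant_invariant.
  by rewrite scale1r.
Qed.

Lemma maximal_star x : A x -> A (star x).
Proof. by case: hA => -[[_ h] _ _] _; exact: h. Qed.

Lemma maximal_commutant x y : A x -> A y -> mul x y = mul y x.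
Proof. by case: hA => -[_ h _] _; exact: h. Qed.

Lemma maximal_invariant t x : A x -> A (omega t x).
Proof. by case: hA => -[_ _ h] _; exact: h. Qed.

(** [A] is its own bicommutant, and commutants are closed under limits. *)
Lemma maximal_closed b :
  (forall e : R, 0 < e -> exists2 a, A a & nrm (a - b) <= e) -> A b.
Proof.
move=> Ab.
have <- : commutant (commutant A) = A.
  apply: maximal_bicommutant => //; [exact: maximal_commutant|exact: maximal_star|].
  by move=> t x Ax; exists 1, (omega t x); rewrite ?scale1r //; exact: maximal_invariant.
have approx n : exists a, A a /\ nrm (a - b) <= 2^-1 ^+ n.
  have [|a Aa ab] := Ab (2^-1 ^+ n); last by exists a.
  by rewrite exprn_gt0 // invr_gt0.
have [u uP] := boolp.choice approx.
apply: (@commutant_cvg _ u) => [n|]; first by apply: commutant2; exact: (uP n).1.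
apply/cvg_nrmP => e /expr_half_lt [N Ne]; exists N => n Nn.
apply: le_lt_trans (uP n).2 (le_lt_trans _ Ne).
by rewrite ler_wiXn2l ?invr_ge0 // invf_le1 ?ler1n.
Qed.

(** Adjoining x and its adjoint to [A] gives a commuting set, by normality; [omega] scales x by [k]
    and the adjoint by the conjugate of [k]. The bicommutant of this set is [A] and contains x. *)
Lemma normal_eigenvector_mem x : commutant A x ->
  mul (star x) x = mul x (star x) ->
  (forall t, exists k : R[i], omega t x = k *: x) -> A x.
Proof.
move=> Ax nx xk; have Asx := commutant_star maximal_star Ax.
suff <- : commutant (commutant (A `|` [set x; star x])) = A.
  by apply: commutant2; right; left.
apply: maximal_bicommutant.
- by move=> a Aa; left.
- move=> a b [Aa|[->|->]] [Ab|[->|->]] //.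
  + exact: maximal_commutant.
  + exact: Ax.
  + exact: Asx.
  + by rewrite Ax.
  + by rewrite Asx.
- move=> a [Aa|[->|->]]; first by left; exact: maximal_star.
    by right; right.
  by right; left; rewrite (starK hB).
- move=> t a [Aa|[->|->]].
  + exists 1, (omega t a); first by left; exact: maximal_invariant.
    by rewrite scale1r.
  + by have [k xE] := xk t; exists k, x => //; right; left.
  + have [k xE] := xk t; exists k^*, (star x); first by right; right.
    by rewrite omega_star xE (starZ hB).
Qed.

(* [p = x^* x] and [q = x x^*] are self-adjoint eigenvectors, so they lie in
   [A] and commute with [x]; then [(p - q)^2 = 0]. *)
Lemma eigenvector_mem x : commutant A x ->
  (forall t, exists k : R[i], omega t x = k *: x) -> A x.
Proof.
move=> Ax xk; have Asx := commutant_star maximal_star Ax.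
have [_ _ _ comM] := commutant_subalgebra A.
have sM (y : B) : star (mul (star y) y) = mul (star y) y.
  by rewrite (starM hB) (starK hB).
have sM' (y : B) : star (mul y (star y)) = mul y (star y).
  by rewrite (starM hB) (starK hB).
have Ap : A (mul (star x) x).
  apply: normal_eigenvector_mem; first exact: comM; first by rewrite sM.
  move=> t; have [k xE] := xk t; exists (k^* * k).
  by rewrite omegaM omega_star xE (starZ hB) (cmulZl hB) (cmulZr hB) scalerA.
have Aq : A (mul x (star x)).
  apply: normal_eigenvector_mem; first exact: comM; first by rewrite sM'.
  move=> t; have [k xE] := xk t; exists (k * k^*).
  by rewrite omegaM omega_star xE (starZ hB) (cmulZl hB) (cmulZr hB) scalerA.
apply: normal_eigenvector_mem => //.
apply/eqP; rewrite -subr_eq0; apply/eqP/nrm_eq0/eqP.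
(* As p - q is self-adjoint, the C*-identity reduces p = q to (p - q)^2 = 0. *)
rewrite -sqrf_eq0 -(nrm_starM hB) (starB hB) sM sM'.
set p := mul (star x) x; set q := mul x (star x).
have pq : mul p q = mul q p by exact: maximal_commutant.
(* Regroup p p as x^* q x and move q, an element of [A], to the left of x^*. *)
have pp : mul p p = mul q p.
  rewrite {1}/p -(cmulA hB) [mul x p](cmulA hB) -/q (cmulA hB) -(Asx _ Aq).
  by rewrite -(cmulA hB).
have qq : mul q q = mul p q.
  rewrite {1}/q -(cmulA hB) [mul (star x) q](cmulA hB) -/p (cmulA hB) -(Ax _ Ap).
  by rewrite -(cmulA hB).
by rewrite (cmulBl hB) !(cmulBr hB) pp qq pq subrr nrm0.
Qed.

(** An abelian set containing [A] lies in the commutant of [A]. *)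
Lemma commutant_maximal_abelian : commutant A `<=` A -> 
  is_maximal_abelian_subalgebra mul A.
Proof.
move=> AA; case: hA => -[[Asub _] Aab _] _; split; first by split.
move=> A' _ A'ab AA'; apply/seteqP; split => // b A'b.
by apply: AA => a /AA' A'a; exact: A'ab.
Qed.
End Commutant.

(** * Means over grids of the circle *)

Section GridMean.
Variables (R : realType) (B : completeNormedModType R[i]).
Implicit Types (F G : R -> B) (N Q : nat).

(** Left-endpoint Riemann sum for the integral over one period. *)
Definition grid_mean F N : B :=
  (N%:R^-1 : R[i]) *: \sum_(0 <= j < N) F (j%:R / N%:R).

Definition uniformly_cont F := forall e : R, 0 < e ->
  exists2 d : R, 0 < d & forall t s, `|s| < d -> nrm (F (t + s) - F t) < e.

Lemma grid_meanB F G N :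
  grid_mean F N - grid_mean G N = grid_mean (fun t => F t - G t) N.
Proof. by rewrite /grid_mean -scalerBr -sumrB. Qed.

Lemma grid_meanZ (k : R[i]) F N :
  grid_mean (fun t => k *: F t) N = k *: grid_mean F N.
Proof. by rewrite /grid_mean -scaler_sumr !scalerA mulrC. Qed.

Lemma grid_mean_sum (I : Type) (r : seq I) (F : I -> R -> B) N :
  grid_mean (fun t => \sum_(i <- r) F i t) N = \sum_(i <- r) grid_mean (F i) N.
Proof. by rewrite /grid_mean exchange_big /= scaler_sumr. Qed.

(** The pointwise bound may vary with t, so that a multiple of the Fejer kernel can be summed
    through its mass. *)
Lemma nrm_grid_mean F N (w : R -> R) (e : R) :
  (forall t, 0 <= t < 1 -> nrm (F t) <= w t) ->
  \sum_(0 <= j < N) w (j%:R / N%:R) <= N%:R * e -> (0 < N)%N ->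
  nrm (grid_mean F N) <= e.
Proof.
move=> Fw wS N0; have N0R : (0 : R) < N%:R by rewrite ltr0n.
rewrite /grid_mean nrmV mulrC ler_pdivrMr // mulrC (le_trans _ wS) //.
apply: le_trans (nrm_sum _ _) _; rewrite !big_mkord; apply: ler_sum => j _.
by apply: Fw; rewrite divr_ge0 //= ltr_pdivrMr // mul1r ltr_nat.
Qed.

Lemma nrm_grid_mean_cst F N (e : R) : (0 < N)%N ->
  (forall t, 0 <= t < 1 -> nrm (F t) <= e) -> nrm (grid_mean F N) <= e.
Proof.
move=> N0 Fe; apply: (nrm_grid_mean (w := fun=> e)) => //.
by rewrite big_const_nat subn0 iter_addr addr0 mulr_natl.
Qed.

(** Each coarse cell holds [Q] fine points, all within 1/N to the right of its left end; the sums
    are compared cell by cell. *)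
Lemma grid_mean_refine F N Q (e : R) : (0 < N)%N -> (0 < Q)%N ->
  (forall t s, 0 <= s < N%:R^-1 -> nrm (F (t + s) - F t) <= e) ->
  nrm (grid_mean F (N * Q) - grid_mean F N) <= e.
Proof.
move=> N0 Q0 Fe.
have N0R : (0 : R) < N%:R by rewrite ltr0n.
have Q0R : (0 : R) < Q%:R by rewrite ltr0n.
have -> : grid_mean F (N * Q) - grid_mean F N =
   grid_mean (fun t => (Q%:R^-1 : R[i]) *:
      \sum_(0 <= q < Q) (F (t + q%:R / (N * Q)%:R) - F t)) N.
  rewrite /grid_mean big_nat_mul natrM invfM -scalerA -scalerBr; congr (_ *: _).
  rewrite scaler_sumr -sumrB; apply: eq_bigr => i _.
  rewrite sumrB scalerBr big_const_nat subn0 iter_addr addr0 -[F _ *+ _]scaler_nat.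
  rewrite scalerA.
  rewrite mulVf ?pnatr_eq0 -?lt0n // scale1r; congr (_ *: _ - _).
  rewrite -{1}[(i * Q)%N]add0n big_addn mulSn addnK.
  apply: eq_bigr => q _; congr F.
  by rewrite natrD !natrM; field; rewrite !gt_eqF.
apply: nrm_grid_mean_cst => // t _.
rewrite nrmV mulrC ler_pdivrMr // (le_trans (nrm_sum _ _)) //.
rewrite big_nat_cond (le_trans (y := \sum_(0 <= q < Q | (0 <= q < Q)%N && true) e)) //.
  apply: ler_sum => q /andP[/andP[_ qQ] _]; apply: Fe.
  rewrite divr_ge0 //= natrM invfM mulrCA gtr_pMr ?invr_gt0 //.
  by rewrite ltr_pdivrMr // mul1r ltr_nat.
by rewrite -big_nat_cond big_const_nat subn0 iter_addr addr0 mulr_natr.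
Qed.

Lemma expn_half_lt (e : R) : 0 < e ->
  exists n0 : nat, forall n, (n0 <= n)%N -> (2 ^ n)%:R^-1 < e.
Proof.
move=> /expr_half_lt [n0 n0e]; exists n0 => n n0n.
apply: le_lt_trans n0e; rewrite natrX -exprVn.
by rewrite ler_wiXn2l ?invr_ge0 // invf_le1 ?ler1n.
Qed.

(** Dyadic grids are nested, so all late means are close to the one at level [n0], which they
    refine. *)
Lemma grid_mean_cvg F : uniformly_cont F ->
  exists l : B, (fun n => grid_mean F (2 ^ n)) @ \oo --> l.
Proof.
move=> uF; apply: cauchy_nrm => e e0.
have e3 : 0 < e / 3 by rewrite divr_gt0.
have [d d0 dF] := uF _ e3; have [n0 n0d] := expn_half_lt d0.
have near n : (n0 <= n)%N ->
    nrm (grid_mean F (2 ^ n) - grid_mean F (2 ^ n0)) <= e / 3.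
  move=> n0n; rewrite -(subnKC n0n) expnD.
  apply: grid_mean_refine; rewrite ?expn_gt0 // => t s /andP[s0 sN].
  by apply/ltW/dF; rewrite ger0_norm // (lt_trans sN) // n0d.
exists n0 => m n /near hm /near hn.
have := nrmD (grid_mean F (2 ^ m) - grid_mean F (2 ^ n0))
  (grid_mean F (2 ^ n0) - grid_mean F (2 ^ n)).
by rewrite addrA subrK (nrmB (grid_mean F (2 ^ n0))); lra.
Qed.

Lemma grid_mean_shift_grid F N m : (0 < N)%N ->
  (forall t, F (t + 1) = F t) ->
  grid_mean (fun t => F (t + m%:R / N%:R)) N = grid_mean F N.
Proof.
move=> N0 per; have N0R : (N%:R : R) != 0 by rewrite pnatr_eq0 -lt0n.
elim: m => [|m IH].
  by rewrite /grid_mean; congr (_ *: _); apply: eq_bigr => j _; rewrite mul0r addr0.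
rewrite -[RHS]IH /grid_mean; congr (_ *: _).
case: N N0 N0R {IH} => // N _ N0R.
(* One more grid step rotates the points: the last point on the left is the first on the right plus
   one period. *)
rewrite big_nat_recr //= [RHS]big_nat_recl //= addrC; congr (_ + _).
  by rewrite -[RHS]per; congr F; rewrite -(natr1 m) -(natr1 N) mul0r; field;
    rewrite natr1.
by apply: eq_bigr => j _; congr F; rewrite -(natr1 m) -(natr1 j); field.
Qed.

(** Round [s] down to a grid point m/N: uniform continuity bounds the error, and grid shifts leave
    the mean unchanged. Truncation to a natural number is why [s] is nonnegative here. *)
Lemma grid_mean_shift_ge0 F s (l : B) : uniformly_cont F ->
  (forall t, F (t + 1) = F t) -> 0 <= s ->
  (fun n => grid_mean F (2 ^ n)) @ \oo --> l ->
  (fun n => grid_mean (fun t => F (t + s)) (2 ^ n)) @ \oo --> l.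
Proof.
move=> uF per s0 /cvg_nrmP Fl; apply/cvg_nrmP => e e0.
have e2 : 0 < e / 2 by rewrite divr_gt0.
have [n1 n1P] := Fl _ e2; have [d d0 dF] := uF _ e2.
have [n2 n2P] := expn_half_lt d0.
exists (maxn n1 n2) => n; rewrite geq_max => /andP[/n1P h1 /n2P h2].
set N := (2 ^ n)%N in h1 h2 *; have N0 : (0 < N)%N by rewrite expn_gt0.
have N0R : (0 : R) < N%:R by rewrite ltr0n.
set m := Num.truncn (s * N%:R).
have /truncn_itv /andP[m1 m2] : 0 <= s * N%:R by rewrite mulr_ge0.
have : nrm (grid_mean (fun t => F (t + s)) N -
            grid_mean (fun t => F (t + m%:R / N%:R)) N) <= e / 2.
  rewrite grid_meanB; apply: nrm_grid_mean_cst => // t _.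
  rewrite -[t + s](_ : t + m%:R / N%:R + (s - m%:R / N%:R) = _); last by ring.
  apply/ltW/dF; rewrite ger0_norm ?subr_ge0 ?ler_pdivrMr //.
  apply: lt_trans h2; rewrite ltrBlDr -[X in _ < X + _]mul1r -mulrDl.
  by rewrite nat1r ltr_pdivlMr.
rewrite grid_mean_shift_grid // => h3.
have := nrmD (grid_mean (fun t => F (t + s)) N - grid_mean F N) (grid_mean F N - l).
by rewrite addrA subrK; lra.
Qed.

Lemma grid_mean_shift F s (l : B) : uniformly_cont F ->
  (forall t, F (t + 1) = F t) ->
  (fun n => grid_mean F (2 ^ n)) @ \oo --> l ->
  (fun n => grid_mean (fun t => F (t + s)) (2 ^ n)) @ \oo --> l.
Proof.
move=> uF per Fl; have [s0|s0] := leP 0 s; first exact: grid_mean_shift_ge0.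
have uFs : uniformly_cont (fun t => F (t + s)).
  by move=> e /uF [d d0 dF]; exists d => // t r /(dF (t + s)); rewrite addrAC.
(* For negative [s], shifting the translate back by [- s] recovers [F], so the two limits agree. *)
have [l' Fl'] := grid_mean_cvg uFs.
have pers t : F (t + 1 + s) = F (t + s) by rewrite addrAC per.
have Ns : 0 <= - s by rewrite oppr_ge0 ltW.
have := grid_mean_shift_ge0 uFs pers Ns Fl'.
rewrite (_ : (fun t => _) = F); last by apply/funext => t; rewrite subrK.
by move=> /(cvg_nrm_unique Fl) ->.
Qed.

End GridMean.

(** * The Fejer kernel *)

Section Fejer.
Variable R : realType.
Implicit Types (r s t : R).

(** The character e^(2 pi i t), of period 1 like the circle R/Z. *)
Definition chi t : R[i] := (cos (pi *+ 2 * t) +i* sin (pi *+ 2 * t))%C.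

Lemma chiD s t : chi (s + t) = chi s * chi t.
Proof.
rewrite /chi mulrDr cosD sinD; apply/eqP; rewrite eq_complex /= eqxx /=.
by rewrite addrC eqxx.
Qed.

Lemma chi0 : chi 0 = 1.
Proof. by rewrite /chi mulr0 cos0 sin0. Qed.

Lemma chiV t : chi (- t) * chi t = 1.
Proof. by rewrite -chiD addNr chi0. Qed.

Lemma conjc_chi t : ((chi t)^*)%C = chi (- t).
Proof. by rewrite /chi mulrN cosN sinN. Qed.

Lemma chi_nat n : chi n%:R = 1.
Proof.
have chi1 : chi 1 = 1.
  by rewrite /chi mulr1 cos2pi sin2pi.
by elim: n => [|n IH]; rewrite ?chi0 // -natr1 chiD IH chi1 mulr1.
Qed.

Lemma chi_natB m n : chi (m%:R - n%:R) = 1.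
Proof.
by rewrite chiD chi_nat mul1r -[chi (- _)]mulr1 -{1}(chi_nat n) chiV.
Qed.

Lemma chi_mulrn t n : chi (t * n%:R) = chi t ^+ n.
Proof.
elim: n => [|n IH]; first by rewrite mulr0 chi0.
by rewrite -natr1 mulrDr mulr1 chiD IH exprSr.
Qed.

Lemma nrm_chi t : nrm (chi t) = 1.
Proof. by rewrite /nrm normc_def /= cos2Dsin2 sqrtr1. Qed.

Lemma nrm_sub1_chi t : nrm (chi t - 1) ^+ 2 = 2 - 2 * cos (pi *+ 2 * t).
Proof.
rewrite /nrm normc_def /= sqr_sqrtr ?addr_ge0 ?sqr_ge0 // subr0.
by have := cos2Dsin2 (pi *+ 2 * t); rewrite !expr2; lra.
Qed.

Lemma chi_continuous0 (e : R) : 0 < e ->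
  exists2 d : R, 0 < d & forall t, `|t| < d -> nrm (chi t - 1) < e.
Proof.
move=> e0; have e2 : 0 < e ^+ 2 / 2 by rewrite divr_gt0 ?exprn_gt0.
have /cvgrPdist_lt /(_ _ e2) /nbhs_ballP [d d0 dP] := @continuous_cos R 0.
have p2 : 0 < pi *+ 2 :> R by rewrite pmulrn_lgt0 ?pi_gt0.
exists (d / (pi *+ 2)); first by rewrite divr_gt0.
move=> t; rewrite ltr_pdivlMr // => td.
have := dP (pi *+ 2 * t); rewrite /ball /= sub0r normrN normrM.
rewrite (ger0_norm (ltW p2)) mulrC => /(_ td); rewrite cos0 => /ltr_normlW h.
rewrite -(@ltr_pXn2r _ 2) ?nnegrE ?nrm_ge0 ?(ltW e0) // nrm_sub1_chi.
by move: h; lra.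
Qed.

(** The cosine decreases on [0, pi], which settles t <= 1/2; the reflection t to 1 - t gives the
    rest. *)
Lemma nrm_sub1_chi_gap (d t : R) : 0 < d -> d <= t <= 1 - d ->
  0 < 2 - 2 * cos (pi *+ 2 * d) <= nrm (chi t - 1) ^+ 2.
Proof.
move=> d0 /andP[dt td]; have p0 := pi_gt0 R.
have mono (x y : R) : 0 <= x -> x <= y -> y <= 2^-1 ->
    cos (pi *+ 2 * y) <= cos (pi *+ 2 * x).
  move=> x0 xy y1; rewrite leNgt ltr_cos ?in_itv /= ?mulr2n.
  - by rewrite -leNgt ler_wpM2l // addr_ge0 // ltW.
  - by apply/andP; split; nra.
  - by apply/andP; split; nra.
have gap (x : R) : d <= x -> x <= 2^-1 ->
    2 - 2 * cos (pi *+ 2 * d) <= nrm (chi x - 1) ^+ 2.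
  by move=> dx x1; rewrite nrm_sub1_chi; have := mono d x (ltW d0) dx x1; lra.
apply/andP; split.
  have : cos (pi *+ 2 * d) < cos 0.
    rewrite ltr_cos ?in_itv /= ?mulr2n ?lexx ?(ltW p0) //; first by nra.
    by apply/andP; split; nra.
  by rewrite cos0; lra.
have [t1|t1] := leP t 2^-1; first exact: gap.
have -> : nrm (chi t - 1) = nrm (chi (1 - t) - 1).
  apply/eqP; rewrite -(@eqrXn2 _ 2) ?nrm_ge0 // !nrm_sub1_chi mulrBr mulr1.
  by rewrite [pi *+ 2 - _]addrC cosD2pi cosN.
by apply: gap; lra.
Qed.

Lemma chi_neq1 t : 0 < `|t| < 1 -> chi t != 1.
Proof.
move=> /andP[t0 t1]; pose d := Num.min `|t| (1 - `|t|).
have d0 : 0 < d by rewrite lt_min t0 subr_gt0.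
have dt : d <= `|t| <= 1 - d.
  by rewrite ge_min lexx /= lerBrDr -lerBrDl ge_min lexx orbT.
have /andP[g0 /(lt_le_trans g0)] := nrm_sub1_chi_gap d0 dt.
have -> : nrm (chi `|t| - 1) ^+ 2 = nrm (chi t - 1) ^+ 2.
  by rewrite !nrm_sub1_chi; case: (ger0P t) => // _; rewrite mulrN cosN.
by apply: contraTneq => ->; rewrite subrr nrm0 expr0n ltxx.
Qed.

(** A geometric sum whose ratio is an N-th root of unity, different from 1 because 0 < |i - j| <
    N. *)
Lemma chi_orthogonal N i j : (i < N)%N -> (j < N)%N -> i != j ->
  \sum_(0 <= m < N) chi ((i%:R - j%:R) * (m%:R / N%:R)) = 0.
Proof.
move=> iN jN ij; have N0 : (0 : R) < N%:R by rewrite ltr0n (leq_trans _ iN).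
pose z := chi ((i%:R - j%:R) / N%:R).
have z1 : z - 1 != 0.
  rewrite subr_eq0; apply: chi_neq1.
  rewrite normrM normfV [`|N%:R|]ger0_norm ?(ltW N0) // ltr_pdivrMr // mul1r.
  rewrite divr_gt0 ?normr_gt0 ?subr_eq0 ?eqr_nat //= ltr_norml.
  have := ler0n R i; have := ler0n R j.
  have : (i%:R : R) < N%:R by rewrite ltr_nat.
  have : (j%:R : R) < N%:R by rewrite ltr_nat.
  by move=> ? ? ? ?; apply/andP; split; lra.
have zN : z ^+ N = 1 by rewrite -chi_mulrn divfK ?gt_eqF // chi_natB.
apply: (mulfI z1); rewrite mulr0 big_mkord.
rewrite (eq_bigr (fun m : 'I_N => z ^+ m)) => [|m _].
  by rewrite -subrX1 zN subrr.
by rewrite -chi_mulrn mulrA mulrAC.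
Qed.

Definition fejer (K : nat) t : R :=
  K%:R^-1 * nrm (\sum_(0 <= i < K) chi (i%:R * t)) ^+ 2.

Lemma fejer_ge0 K t : 0 <= fejer K t.
Proof. by rewrite mulr_ge0 ?invr_ge0 ?sqr_ge0. Qed.

(** Equal differences i - j are left uncollected, which avoids the weights 1 - |n|/K. *)
Lemma fejerE K t : ((fejer K t)%:C)%C =
  K%:R^-1 * \sum_(0 <= i < K) \sum_(0 <= j < K) chi ((i%:R - j%:R) * t).
Proof.
rewrite /fejer rmorphM fmorphV rmorph_nat; congr (_ * _).
have conj_sum : ((\sum_(0 <= j < K) chi (j%:R * t))^*)%C =
    \sum_(0 <= j < K) chi (- (j%:R * t)).
  by rewrite rmorph_sum; apply: eq_bigr => j _; exact: conjc_chi.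
rewrite rmorphXn /= -nrmE sqr_normc conj_sum mulr_suml; apply: eq_bigr => i _.
by rewrite mulr_sumr; apply: eq_bigr => j _; rewrite -chiD mulrBl.
Qed.

(** Multiplying the geometric sum by [chi t - 1] leaves a difference of two numbers of modulus 1. *)
Lemma fejer_decay K t : fejer K t * nrm (chi t - 1) ^+ 2 <= 4 / K%:R.
Proof.
rewrite /fejer -mulrA mulrC ler_wpM2r ?invr_ge0 //.
have -> : \sum_(0 <= i < K) chi (i%:R * t) = \sum_(i < K) chi t ^+ i.
  by rewrite big_mkord; apply: eq_bigr => i _; rewrite mulrC chi_mulrn.
rewrite -exprMn -nrmM mulrC -subrX1 -chi_mulrn.
have n1 : nrm (1 : R[i]) = 1 by rewrite -chi0 nrm_chi.
have := nrmD (chi (t * K%:R)) (- 1); rewrite nrm_chi nrmN n1.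
by have := nrm_ge0 (chi (t * K%:R) - 1); nra.
Qed.

(** The grid mean is exactly 1: with K <= N no nonzero frequency i - j aliases to 0, and the [K]
    diagonal terms give [N] each. *)
Lemma fejer_mass K N : (0 < K)%N -> (K <= N)%N ->
  \sum_(0 <= m < N) fejer K (m%:R / N%:R) = N%:R.
Proof.
move=> K0 KN; apply: complexI; rewrite rmorph_sum rmorph_nat /=.
under eq_bigr do rewrite fejerE.
rewrite -mulr_sumr exchange_big /=.
have -> : \sum_(0 <= i < K) \sum_(0 <= m < N) \sum_(0 <= j < K)
    chi ((i%:R - j%:R) * (m%:R / N%:R)) = \sum_(0 <= i < K) N%:R.
  rewrite !big_mkord; apply: eq_bigr => i _; rewrite exchange_big /= big_mkord.
  rewrite (bigD1 i) //= [X in _ + X]big1 ?addr0 => [|j ji].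
    under eq_bigr do rewrite subrr mul0r chi0.
    by rewrite big_const_nat subn0 iter_addr addr0.
  apply: chi_orthogonal; last by rewrite eq_sym.
    by apply: leq_trans KN.
  by apply: leq_trans KN.
by rewrite big_const_nat subn0 iter_addr addr0 -[N%:R *+ K]mulr_natl mulrA mulVf ?mul1r //
  pnatr_eq0 -lt0n.
Qed.

Variable B : completeNormedModType R[i].

(** Within [d] of an integer, uniform continuity bounds the deviation by e/2; elsewhere decay of the
    kernel bounds the term by (4 / (K g)) (2 M). The choice of [K] is uniform in the grid. *)
Lemma fejer_approx (F : R -> B) (M e : R) : 0 < e -> uniformly_cont F ->
  (forall t, F (t + 1) = F t) -> (forall t, nrm (F t) <= M) ->
  exists2 K, (0 < K)%N & forall N, (K <= N)%N ->
    nrm (grid_mean (fun t => ((fejer K t)%:C)%C *: F t) N - F 0) <= e.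
Proof.
move=> e0 uF per FM; have e2 : 0 < e / 2 by rewrite divr_gt0.
have [d' d'0 dF] := uF _ e2.
pose d := Num.min d' 2^-1.
have d0 : 0 < d by rewrite lt_min d'0 invr_gt0 ltr0n.
have dd' : d <= d' by rewrite ge_min lexx.
have dh : d <= d <= 1 - d.
  have : d <= 2^-1 by rewrite ge_min lexx orbT.
  by rewrite lexx /=; lra.
have /andP[g0 _] := nrm_sub1_chi_gap d0 dh.
set g := 2 - 2 * cos (pi *+ 2 * d) in g0.
have M0 : 0 <= M by apply: le_trans (FM 0); exact: nrm_ge0.
(* Chosen so that 8 M / (K g) <= e / 2. *)
pose K := (Num.truncn (16 * M / (g * e))).+1.
have K0R : (0 : R) < K%:R by rewrite ltr0n.
have KM : 8 * M / (K%:R * g) <= e / 2.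
  have : 16 * M / (g * e) < K%:R by exact: truncnS_gt.
  rewrite ltr_pdivrMr ?mulr_gt0 // ler_pdivrMr ?mulr_gt0 //.
  by nra.
exists K => // N KN; have N0 : (0 < N)%N by apply: leq_trans KN.
have N0R : (N%:R : R[i]) != 0 by rewrite pnatr_eq0 -lt0n.
have -> : F 0 = grid_mean (fun t => ((fejer K t)%:C)%C *: F 0) N.
  rewrite /grid_mean -scaler_suml -rmorph_sum fejer_mass //= rmorph_nat.
  by rewrite scalerA mulVf // scale1r.
rewrite grid_meanB.
apply: (nrm_grid_mean (w := fun t => fejer K t * (e / 2) + 8 * M / (K%:R * g))) => //.
  move=> t /andP[t0 t1]; rewrite -scalerBr nrmZ nrm_real ger0_norm ?fejer_ge0 //.
  have c0 : 0 <= 8 * M / (K%:R * g) by rewrite divr_ge0 ?mulr_ge0 ?(ltW g0).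
  have near : nrm (F t - F 0) < e / 2 ->
      fejer K t * nrm (F t - F 0) <= fejer K t * (e / 2) + 8 * M / (K%:R * g).
    by move=> /ltW h; rewrite ler_wpDr // ler_wpM2l ?fejer_ge0.
  have [td|dt] := ltP t d.
    apply: near; have := dF 0 t; rewrite add0r; apply.
    by rewrite ger0_norm // (lt_le_trans td).
  have [td|td] := ltP (1 - d) t.
    apply: near; rewrite -(subrK 1 t) per; have := dF 0 (t - 1); rewrite add0r; apply.
    by rewrite ltr0_norm ?subr_lt0 //; lra.
  have /andP[_] := @nrm_sub1_chi_gap d t d0 (introT andP (conj dt td)).
  rewrite -/g => gt.
  have fg : fejer K t * g <= 4 / K%:R.
    by apply: le_trans (fejer_decay K t); rewrite ler_wpM2l ?fejer_ge0.
  have F2 : nrm (F t - F 0) <= 2 * M.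
    by have := nrmD (F t) (- F 0); rewrite nrmN; have := FM t; have := FM 0; lra.
  apply: ler_wpDl; first by rewrite mulr_ge0 ?fejer_ge0 ?(ltW e2).
  rewrite invfM mulrA ler_pdivlMr // mulrAC.
  have := ler_pM (mulr_ge0 (fejer_ge0 K t) (ltW g0)) (nrm_ge0 _) fg F2.
  by move/le_trans; apply; rewrite le_eqVlt; apply/orP; left; apply/eqP; ring.
rewrite big_split /= -mulr_suml fejer_mass // big_const_nat subn0 iter_addr addr0.
by rewrite -[(8 * M / _) *+ N]mulr_natl -mulrDr ler_wpM2l //; lra.
Qed.
End Fejer.

(** * Fourier coefficients *)

Section Spectral.
Variables (R : realType) (B : completeNormedModType R[i]).
Variables (mul : B -> B -> B) (star : B -> B).
Hypothesis hB : is_Cstar_algebra mul star.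
Variable omega : R -> B -> B.
Hypothesis homega : is_Cstar_dynamical_system mul star omega.

(** An increment at t is the image under [omega t], up to a unimodular factor, of the increment at
    0; the uniform bound 2 on [omega t] then makes continuity at 0 uniform. *)
Lemma omega_uniformly_cont (r : R) b :
  uniformly_cont (fun t => chi (r * t) *: omega t b).
Proof.
move=> e e0; have e4 : 0 < e / 4 by rewrite divr_gt0.
have b1 : 0 < nrm b + 1 by rewrite ltr_wpDl ?nrm_ge0.
have r1 : 0 < `|r| + 1 by rewrite ltr_wpDl.
have [d d0 dP] := omega_continuous0 homega b e4.
have [c c0 cP] := chi_continuous0 (divr_gt0 e4 b1).
exists (Num.min d (c / (`|r| + 1))); first by rewrite lt_min d0 divr_gt0.
move=> t s; rewrite lt_min => /andP[/dP sd sc].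
have -> : chi (r * (t + s)) *: omega (t + s) b - chi (r * t) *: omega t b =
    chi (r * t) *: omega t (chi (r * s) *: omega s b - b).
  rewrite mulrDr chiD (omega_add homega) (omegaB homega) (omegaZ homega).
  by rewrite scalerBr scalerA.
rewrite nrmZ nrm_chi mul1r; apply: le_lt_trans (nrm_omega hB homega _ _) _.
have -> : chi (r * s) *: omega s b - b =
    chi (r * s) *: (omega s b - b) + (chi (r * s) - 1) *: b.
  by rewrite scalerBr scalerBl scale1r addrA subrK.
have := nrmD (chi (r * s) *: (omega s b - b)) ((chi (r * s) - 1) *: b).
rewrite !nrmZ nrm_chi mul1r.
have : nrm (chi (r * s) - 1) < e / 4 / (nrm b + 1).
  apply: cP; rewrite normrM; move: sc; rewrite ltr_pdivlMr // => sc.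
  by apply: le_lt_trans sc; rewrite mulrC ler_wpM2l // lerDl.
rewrite ltr_pdivlMr // => h; have := nrm_ge0 (chi (r * s) - 1).
by move: h sd; rewrite mulrDr; lra.
Qed.

Lemma omega_twisted_period (r : R) b t : chi r = 1 ->
  chi (r * (t + 1)) *: omega (t + 1) b = chi (r * t) *: omega t b.
Proof. by move=> r1; rewrite (omega_period homega) mulrDr mulr1 chiD r1 mulr1. Qed.

(* The limit is the Fourier coefficient of [b] of frequency [- r]. *)
Lemma fourier_eigenvector (r : R) b l s : chi r = 1 ->
  (fun n => grid_mean (fun t => chi (r * t) *: omega t b) (2 ^ n)) @ \oo --> l ->
  omega s l = chi (- (r * s)) *: l.
Proof.
move=> r1 bl.
have per t := omega_twisted_period b t r1.
have bs := grid_mean_shift s (omega_uniformly_cont r b) per bl.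
have sl : (fun n => omega s (grid_mean (fun t => chi (r * t) *: omega t b) (2 ^ n)))
    @ \oo --> omega s l.
  apply: (cvg_additive (omegaB homega s) (C := 2)) bl => x.
  exact: (nrm_omega hB homega).
apply: (cvg_nrm_unique sl).
pose F (x : B) := chi (- (r * s)) *: x.
have FB x y : F (x - y) = F x - F y by exact: scalerBr.
have FC x : nrm (F x) <= 1 * nrm x by rewrite nrmZ nrm_chi.
(* Applying [omega s] to a mean gives [chi (- (r * s))] times the mean translated by [s], which also
   tends to [l]. *)
rewrite -/(F l) [X in X @ _ --> _](_ : _ = F \o (fun n => grid_mean
    (fun t => chi (r * (t + s)) *: omega (t + s) b) (2 ^ n))).
  exact: (cvg_additive FB FC bs).
apply/funext => n; rewrite /F /= /grid_mean scalerA mulrC -scalerA.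
rewrite (omegaZ homega); congr (_ *: _).
rewrite scaler_sumr.
rewrite (omega_sum homega); apply: eq_bigr => j _.
rewrite (omegaZ homega) scalerA mulrDr chiD [chi (- _) * _]mulrCA chiV mulr1 [_ + s]addrC.
by rewrite (omega_add homega).
Qed.

Variable A : set B.
Hypothesis hA :
  is_maximal_abelian_T_invariant_star_subalgebra mul star omega A.

Lemma commutant_omega t b : commutant mul A b -> commutant mul A (omega t b).
Proof.
move=> Ab; apply: (commutant_invariant hB homega) Ab => {}t x Ax.
by exists 1, (omega t x); [exact: (maximal_invariant hA)|rewrite scale1r].
Qed.

Lemma sum_mem (X : set B) (I : Type) (r : seq I) (F : I -> B) :
  is_subalgebra mul X -> (forall i, X (F i)) -> X (\sum_(i <- r) F i).
Proof.
move=> [X0 XD _ _] XF; elim: r => [|i r IH]; rewrite ?big_nil ?big_cons //.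
exact: XD.
Qed.

Lemma commutant_sub_maximal : commutant mul A `<=` A.
Proof.
move=> b Ab; apply: (maximal_closed hB homega hA) => e e0.
have Asub : is_subalgebra mul A by case: hA => -[[]].
(* These are the terms of the Fejer mean expanded by [fejerE]; their mean limits [l i j] are Fourier
   coefficients. *)
pose f (i j : nat) (t : R) := chi ((i%:R - j%:R) * t) *: omega t b.
have f_lim i : exists l : nat -> B, forall j,
    (fun n => grid_mean (f i j) (2 ^ n)) @ \oo --> l j.
  have fj j : exists l : B, (fun n => grid_mean (f i j) (2 ^ n)) @ \oo --> l.
    exact: grid_mean_cvg (omega_uniformly_cont _ _).
  by have [l lP] := boolp.choice fj; exists l.
have [l lP] := boolp.choice f_lim.
have Al i j : A (l i j).
  apply: (eigenvector_mem hB homega hA) => [|t].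
    apply: (commutant_cvg hB) (lP i j) => n.
    have [_ _ cZ _] := commutant_subalgebra hB A.
    apply: (cZ); apply: sum_mem (commutant_subalgebra hB A) _ => m.
    by apply: (cZ); exact: commutant_omega.
  exists (chi (- ((i%:R - j%:R) * t))).
  exact: (fourier_eigenvector t (chi_natB _ i j) (lP i j)).
have uF : uniformly_cont (fun t => omega t b).
  move=> x /(omega_uniformly_cont 0 b) [d d0 dP]; exists d => // t s /(dP t).
  by rewrite !mul0r chi0 !scale1r.
have bd t : nrm (omega t b) <= 2 * nrm b by exact: (nrm_omega hB homega).
have [K K0 KP] := fejer_approx e0 uF (fun t => omega_period homega t b) bd.
(* This element of [A] is the limit of the grid means of the kernel times the orbit of [b]. *)
exists ((K%:R^-1 : R[i]) *: \sum_(0 <= i < K) \sum_(0 <= j < K) l i j).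
  by case: (Asub) => _ _ AZ _; apply: AZ; do 2!apply: sum_mem => // ?.
have meanE n : grid_mean (fun t => ((fejer K t)%:C)%C *: omega t b) n =
    (K%:R^-1 : R[i]) *: \sum_(0 <= i < K) \sum_(0 <= j < K) grid_mean (f i j) n.
  have -> : (fun t => ((fejer K t)%:C)%C *: omega t b) =
      (fun t => (K%:R^-1 : R[i]) *: \sum_(0 <= i < K) \sum_(0 <= j < K) f i j t).
    apply/funext => t; rewrite fejerE -scalerA scaler_suml; congr (_ *: _).
    by apply: eq_bigr => i _; rewrite scaler_suml.
  rewrite grid_meanZ grid_mean_sum; congr (_ *: _).
  by apply: eq_bigr => i _; rewrite grid_mean_sum.
have /cvg_nrmP mean_lim :
    (fun n => grid_mean (fun t => ((fejer K t)%:C)%C *: omega t b) (2 ^ n)) @ \oo -->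
    (K%:R^-1 : R[i]) *: \sum_(0 <= i < K) \sum_(0 <= j < K) l i j.
  rewrite (_ : (fun n => _) = (fun n => (K%:R^-1 : R[i]) *:
    \sum_(0 <= i < K) \sum_(0 <= j < K) grid_mean (f i j) (2 ^ n))); last first.
    by apply/funext => n; exact: meanE.
  apply: cvgZ; first exact: cvg_cst.
  apply: cvg_big => [|i _]; first exact: add_continuous.
  apply: cvg_big => [|j _]; first exact: add_continuous.
  exact: lP.
apply/ler_addgt0Pr => x x0; have [N NP] := mean_lim _ x0.
(* The level is at least [N] for the limit, and the grid has at least [K] points since K < 2^K. *)
have := NP _ (leq_maxl N K); have := KP (2 ^ maxn N K)%N.
rewrite (leq_trans (leq_maxr N K)) ?(ltnW (ltn_expl _ _)) // => /(_ isT).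
rewrite (omega0 homega); set y := grid_mean _ _ => h1 h2.
have := nrmD (- (y - (K%:R^-1 : R[i]) *:
  \sum_(0 <= i < K) \sum_(0 <= j < K) l i j)) (y - b).
by rewrite nrmN opprB addrA subrK; lra.
Qed.

End Spectral.

Theorem theorem2p7 (R : realType) (B : completeNormedModType R[i])
    (mul : B -> B -> B) (star : B -> B) (omega : R -> B -> B)
    (hB : is_Cstar_algebra mul star)
    (homega : is_Cstar_dynamical_system mul star omega)
    (A : set B)
    (hA : is_maximal_abelian_T_invariant_star_subalgebra mul star omega A) :
  is_maximal_abelian_subalgebra mul A.
Proof.
apply: (commutant_maximal_abelian hA).
exact: (commutant_sub_maximal hB homega hA).
Qed.
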